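(* Let $(X,\tau_X)$ be a $\sigma$-locally compact Hausdorff space and let $(Y,d_Y)$ be a complete metric space. Let $BC(X,Y)$ be the space of bounded continuous functions $X\to Y$ with the topology of uniform convergence. A set $K\subset BC(X,Y)$ is relatively compact in $BC(X,Y)$ if and only if both of the following conditions hold: (AA1) $K$ is pointwise relatively compact (i.e. for every $x\in X$ the set $\{f(x): f\in K\}$ is relatively compact in $Y$) and $K$ is equicontinuous at every point of $X$; (AA2) $K$ satisfies the $BC(X,Y)$-extension condition: for every $\varepsilon>0$ there exist a compact set $D\subset X$ and $\delta>0$ such that for all $f,g\in K$ $$\sup_{x\in D} d_Y(f(x),g(x))\le\delta\ \Longrightarrow\ \sup_{x\in X} d_Y(f(x),g(x))\le\varepsilon .$$
   Context: A topological space $X$ is called $\sigma$-locally compact if it is locally compact and $X=\bigcup_{n=1}^\infty S_n$ for some sequence $(S_n)_{n\ge1}$ of compact sets. The topology of uniform convergence on $BC(X,Y)$ is given by the metric $d_{BC(X,Y)}(f,g)=\sup_{x\in X}d_Y(f(x),g(x))$. *)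

(* Defs.v *)
From HB Require Import structures.
From mathcomp Require Import all_boot all_order all_algebra.
From mathcomp Require Import all_classical all_reals all_analysis.

Set Implicit Arguments.
Unset Strict Implicit.
Unset Printing Implicit Defensive.

Import Order.TTheory GRing.Theory Num.Theory.

Local Open Scope classical_set_scope.
Local Open Scope ring_scope.

(* The library's [locally_compact] asks for closed compact neighbourhoods, which
   in a Hausdorff space are just the compact ones. *)
Definition sigma_locally_compact (X : topologicalType) : Prop :=
  locally_compact [set: X] /\
  exists S : nat -> set X,
    (forall n, compact (S n)) /\ \bigcup_n S n = [set: X].

(* [completeType] is not used because it extends [pointedType], which would
   rule out the empty metric space. *)
Definition complete_metric (R : realType) (Y : metricType R) : Prop :=
  forall u : nat -> Y, cauchy (u @ \oo) -> exists l : Y, u @ \oo --> l.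

(* The range has finite diameter; unlike "contained in some ball", this also
   makes sense when [Y] is empty. *)
Definition bounded_range (R : realType) (X : Type) (Y : metricType R)
    (f : X -> Y) : Prop :=
  exists M : R, forall x x' : X, mdist (f x) (f x') <= M.

(* The real [sup] of the empty set is [0], which is the supremum of the empty
   set in [[0, +oo[]; on an unbounded set of values [sup] is a junk value, but
   this does not arise for functions with bounded range. *)
Definition sup_dist (R : realType) (X : Type) (Y : metricType R) (A : set X)
    (f g : X -> Y) : R :=
  sup [set mdist (f x) (g x) | x in A].

Record BC (R : realType) (X : topologicalType) (Y : metricType R) : Type :=
  MkBC {
    BCfun :> X -> Y ;
    BC_continuous : continuous BCfun ;
    BC_bounded : bounded_range BCfun
  }.

HB.instance Definition _ (R : realType) (X : topologicalType)
  (Y : metricType R) := gen_eqMixin (BC X Y).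
HB.instance Definition _ (R : realType) (X : topologicalType)
  (Y : metricType R) := gen_choiceMixin (BC X Y).

Section BC_metric.
Context {R : realType} {X : topologicalType} {Y : metricType R}.
Implicit Types f g h : BC X Y.

Lemma BC_eqP f g : (forall x, f x = g x) -> f = g.
Proof.
case: f g => [f cf bf] [g cg bg] /= /funext fg.
by subst g; congr MkBC; exact: Prop_irrelevance.
Qed.

Lemma BC_dist_bounded f g :
  exists M : R, forall x, mdist (f x) (g x) <= M.
Proof.
have [[x0]|X0] := pselect (exists x : X, True); last first.
  by exists 0 => x; case: X0; exists x.
have [Mf fM] := BC_bounded f; have [Mg gM] := BC_bounded g.
exists (Mf + (mdist (f x0) (g x0) + Mg)) => x.
apply: (le_trans (metric_triangle _ (f x0) _)); apply: lerD => //.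
by apply: (le_trans (metric_triangle _ (g x0) _)); apply: lerD.
Qed.

Lemma BC_dist_has_ubound (A : set X) f g :
  has_ubound [set mdist (f x) (g x) | x in A].
Proof. by have [M fgM] := BC_dist_bounded f g; exists M => _ [x _ <-]. Qed.

Definition BC_dist f g : R := sup_dist [set: X] f g.

Lemma le_BC_dist f g x : mdist (f x) (g x) <= BC_dist f g.
Proof. by apply: ub_le_sup; [exact: BC_dist_has_ubound | exists x]. Qed.

Lemma BC_dist_le f g (M : R) :
  0 <= M -> (forall x, mdist (f x) (g x) <= M) -> BC_dist f g <= M.
Proof.
move=> M0 fgM; rewrite /BC_dist /sup_dist.
have [->|/set0P fg0] := eqVneq [set mdist (f x) (g x) | x in [set: X]] set0.
  by rewrite sup0.
by apply: ge_sup => // _ [x _ <-].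
Qed.

Lemma BC_dist_ge0 f g : 0 <= BC_dist f g.
Proof.
have [[x _]|X0] := pselect (exists x : X, True).
  exact: le_trans (mdist_ge0 _ _) (le_BC_dist f g x).
rewrite /BC_dist /sup_dist (_ : [set _ | _ in _] = set0) ?sup0//.
by rewrite -subset0 => r [x _ _]; case: X0; exists x.
Qed.

Lemma BC_distxx f : BC_dist f f = 0.
Proof.
apply/eqP; rewrite eq_le BC_dist_ge0 andbT.
by apply: BC_dist_le => // x; rewrite mdistxx.
Qed.

Lemma BC_dist_positivity f g : BC_dist f g = 0 -> f = g.
Proof.
move=> fg0; apply: BC_eqP => x; apply: mdist_positivity; apply/eqP.
by rewrite eq_le mdist_ge0 andbT -fg0 le_BC_dist.
Qed.

Lemma BC_dist_sym f g : BC_dist f g = BC_dist g f.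
Proof.
rewrite /BC_dist /sup_dist; congr sup; apply/seteqP.
by split=> _ [x _ <-]; exists x => //; exact: metric_sym.
Qed.

Lemma BC_dist_triangle g f h : BC_dist f h <= BC_dist f g + BC_dist g h.
Proof.
apply: BC_dist_le => [|x]; first by rewrite addr_ge0 ?BC_dist_ge0.
by apply: (le_trans (metric_triangle _ (g x) _)); rewrite lerD ?le_BC_dist.
Qed.

HB.instance Definition _ := isMetric.Build R (BC X Y)
  BC_distxx BC_dist_positivity BC_dist_sym BC_dist_triangle.

Lemma BC_mdistE f g : mdist f g = sup_dist [set: X] f g.
Proof. by []. Qed.

End BC_metric.

(* The library's [pointwise_precompact] and [equicontinuous] require a pointed
   codomain; the next two definitions are their analogues without that
   restriction. *)
Definition pointwise_relatively_compact (R : realType) (X : topologicalType)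
    (Y : metricType R) (K : set (BC X Y)) : Prop :=
  forall x : X, precompact [set f x | f in K].

Definition equicontinuous_at (R : realType) (X : topologicalType)
    (Y : metricType R) (K : set (BC X Y)) (x : X) : Prop :=
  forall e : R, 0 < e ->
    \forall y \near x, forall f : BC X Y, K f -> mdist (f x) (f y) < e.

Definition BC_extension_condition (R : realType) (X : topologicalType)
    (Y : metricType R) (K : set (BC X Y)) : Prop :=
  forall e : R, 0 < e ->
    exists (D : set X) (delta : R),
      [/\ compact D, 0 < delta &
        forall f g : BC X Y, K f -> K g ->
          sup_dist D f g <= delta -> sup_dist [set: X] f g <= e].

(* Main.v *)
Require Import Defs.
From mathcomp Require Import all_boot all_order all_algebra.
From mathcomp Require Import all_classical all_reals all_analysis.
From mathcomp Require Import lra.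

(** The topological content is carried by filters, and both directions reduce
    uniform closeness on [X] to closeness on a suitable compact set.

    If [K] is contained in a compact set [C], evaluation at a point is
    continuous, so the values at that point stay in a compact set, and
    equicontinuity follows by covering [C].  For the extension condition, two
    functions in [C] either are close, or are separated by their values at some
    point [x]; both alternatives persist nearby in [C `*` C], so by compactness
    finitely many points [x] and one [delta] serve all pairs.  Thus the set [D]
    can even be taken finite ([compact_extension_condition]).

    Conversely, the three conditions pass from [K] to its closure [C], and it
    suffices that every ultrafilter [F] on [C] converges in [C].  By pointwise
    relative compactness [F] converges pointwise to some [l : X -> Y].
    Equicontinuity makes [l] continuous and the convergence uniform on compact
    sets ([equicontinuous_cvg_on_compact]).  The extension condition then turns
    uniform convergence on a suitable compact set into the uniform Cauchy
    property on [X], so [F] converges uniformly to [l], which is bounded because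
    it is uniformly close to some bounded function. *)

Set Implicit Arguments.
Unset Strict Implicit.
Unset Printing Implicit Defensive.

Import Order.TTheory GRing.Theory Num.Theory.
Import metricType_numDomainType.

Local Open Scope classical_set_scope.
Local Open Scope ring_scope.

(** * Limits and distances *)

(** A cluster point of the image of [F] is a limit: the complement of a
    neighbourhood of it cannot have its preimage in [F], so the neighbourhood
    itself does. *)
Lemma ultra_cvg_in_compact (T : Type) (Y : topologicalType)
    (F : set_system T) (h : T -> Y) (A : set Y) :
  UltraFilter F -> compact A -> F (h @^-1` A) -> exists p : Y, h @ F --> p.
Proof.
move=> FU cptA FA; have [p [_ clp]] := cptA (h @ F) _ FA.
exists p => B Bp; have [//|FnB] := in_ultra_setVsetC (h @^-1` B) FU.
by have [y [nBy By]] := clp (~` B) B FnB Bp.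
Qed.

Lemma mdist_lim_le (R : realType) (T : Type) (Y : metricType R)
    (F : set_system T) (u v : T -> Y) (p q : Y) (e : R) :
  ProperFilter F -> u @ F --> p -> v @ F --> q ->
  (\forall t \near F, mdist (u t) (v t) <= e) -> mdist p q <= e.
Proof.
move=> FF /cvgrPdist_lt up /cvgrPdist_lt vq uve.
apply/ler_addgt0Pr => r r0; have r20 : 0 < r / 2 by lra.
have [t [[put qvt] uvt]] :=
  filter_ex (filterI (filterI (up _ r20) (vq _ r20)) uve).
have := metric_triangle p (u t) q; have := metric_triangle (u t) (v t) q.
rewrite /= in put qvt uvt.
rewrite (metric_sym (v t) q); lra.
Qed.

Section bounded_continuous_functions.
Context {R : realType} {X : topologicalType} {Y : metricType R}.
Implicit Types (f g : BC X Y) (C K : set (BC X Y)) (D : set X).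

Lemma le_mdist_BC f g x : mdist (f x) (g x) <= mdist f g.
Proof. exact: le_BC_dist. Qed.

Lemma le_sup_dist D f g x : D x -> mdist (f x) (g x) <= sup_dist D f g.
Proof.
by move=> Dx; apply: ub_le_sup; [exact: BC_dist_has_ubound|exists x].
Qed.

Lemma sup_dist_le D f g (M : R) : 0 <= M ->
  (forall x, D x -> mdist (f x) (g x) <= M) -> sup_dist D f g <= M.
Proof.
move=> M0 fgM; rewrite /sup_dist.
have [->|/set0P fg0] := eqVneq [set mdist (f x) (g x) | x in D] set0.
  by rewrite sup0.
by apply: ge_sup => // _ [x Dx <-]; exact: fgM.
Qed.

Lemma nbhs_BC f (e : R) : 0 < e -> \forall g \near f, mdist f g < e.
Proof. by move=> e0; exact: (cvgr_dist_lt (@cvg_id _ (nbhs f)) e0). Qed.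

Lemma closure_BC_approx K f (e : R) :
  closure K f -> 0 < e -> exists2 g, K g & mdist f g < e.
Proof. by move=> clf e0; have [g [Kg fg]] := clf _ (nbhs_BC f e0); exists g. Qed.

Lemma eval_continuous (x : X) : continuous (fun f : BC X Y => f x).
Proof.
move=> f; apply/(@cvgrPdist_lt _ _ _ (nbhs f)) => e e0.
by apply: filterS (nbhs_BC f e0) => g; apply: le_lt_trans; exact: le_mdist_BC.
Qed.

(** * Consequences of compactness *)

Lemma compact_pointwise_relatively_compact C :
  compact C -> pointwise_relatively_compact C.
Proof.
move=> cptC x; exists [set f x | f in C]; first by move=> y.
have cptCx : compact [set f x | f in C].
  apply: continuous_compact cptC.
  by apply: continuous_subspaceT; exact: eval_continuous.
split=> //; apply: compact_closed cptCx; exact: metric_hausdorff.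
Qed.

(** Around each [f] in [C] the oscillation near [x] is controlled by that of [f]
    itself; compactness of [C] makes the neighbourhood of [x] independent of
    [f]. *)
Lemma compact_equicontinuous C x : compact C -> equicontinuous_at C x.
Proof.
move=> /compact_near_coveringP covC e e0; have e30 : 0 < e / 3 by lra.
apply: (covC _ (nbhs x) (fun y f => mdist (f x) (f y) < e)) => f Cf.
have /cvgrPdist_lt fx : f y @[y --> x] --> f x by exact: BC_continuous.
exists ([set g | mdist f g < e / 3], [set y | mdist (f x) (f y) < e / 3]).
  by split; [exact: nbhs_BC|exact: fx].
move=> [g y] /= [fg fxy].
have := metric_triangle (g x) (f x) (g y).
have := metric_triangle (f x) (f y) (g y).
have := le_mdist_BC f g x; have := le_mdist_BC f g y.
rewrite (metric_sym (g x) (f x)); lra.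
Qed.

(** The index filter consists of the pairs of a finite set of points and a
    tolerance, ordered by enlarging the set and shrinking the tolerance: a pair
    of functions that is distinguished by some index is distinguished by all
    later ones. *)
Lemma compact_extension_condition C : compact C -> BC_extension_condition C.
Proof.
move=> cptC e e0.
pose F := filter_from [set i : seq X * R | 0 < i.2]
  (fun i => [set j : seq X * R | {subset i.1 <= j.1} /\ j.2 <= i.2]).
have FF : Filter F.
  apply: filter_from_filter; first by exists ([::], 1); rewrite /= ltr01.
  move=> [s r] [t q] /= r0 q0; exists (s ++ t, Num.min r q) => /=.
    by rewrite lt_min r0.
  move=> [w d] /= [stw]; rewrite le_min => /andP[dr dq].
  by split; split=> // x xs; apply: stw; rewrite mem_cat xs ?orbT.
pose P (i : seq X * R) (fg : BC X Y * BC X Y) :=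
  (forall x, x \in i.1 -> mdist (fg.1 x) (fg.2 x) <= i.2) ->
  mdist fg.1 fg.2 <= e.
have /compact_near_coveringP/(_ _ F P FF) := compact_setX cptC cptC.
case=> [[f g] _|[s d] /= d0 sdP].
  have [fg|/existsNP[x /eqP fgx]] := pselect (forall x, f x = g x).
    (* Here f = g, and functions close to f are close to each other. *)
    have {fg} <- : f = g by exact: BC_eqP.
    have e20 : 0 < e / 2 by lra.
    exists ([set hk | mdist f hk.1 < e / 2 /\ mdist f hk.2 < e / 2], setT).
      split; last exact: filterT.
      by exists ([set h | mdist f h < e / 2], [set h | mdist f h < e / 2]) => //;
        split; exact: nbhs_BC.
    move=> [[h k] i] /= [[fh fk] _] _ /=; have := metric_triangle h f k.
    rewrite (metric_sym h f); lra.
  (* If f x != g x, then x separates all functions close to f and g. *)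
  have fg0 : 0 < mdist (f x) (g x) by rewrite mdist_gt0.
  set r := mdist (f x) (g x) in fg0; have r40 : 0 < r / 4 by lra.
  exists ([set hk | mdist f hk.1 < r / 4 /\ mdist g hk.2 < r / 4],
      [set j | {subset [:: x] <= j.1} /\ j.2 <= r / 4]).
    split; last by exists ([:: x], r / 4).
    by exists ([set h | mdist f h < r / 4], [set h | mdist g h < r / 4]) => //;
      split; exact: nbhs_BC.
  move=> [[h k] [t d]] /= [[fh gk] [xt dr]] /= /(_ x); rewrite xt ?mem_head//=.
  move=> /(_ isT) hkx.
  have := metric_triangle (f x) (h x) (g x).
  have := metric_triangle (h x) (k x) (g x).
  have := le_mdist_BC f h x; have := le_mdist_BC g k x.
  rewrite (metric_sym (k x)) -/r; lra.
exists [set` s], d; split=> // [|f g Cf Cg fgd].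
  by apply: finite_compact; exact: finite_seq.
apply: (sdP (s, d) _ (f, g)) => //= [|x xs]; first by split.
by apply: le_trans fgd; exact: le_sup_dist.
Qed.

(** * Passing to the closure *)

Lemma pointwise_relatively_compact_closure K :
  pointwise_relatively_compact K -> pointwise_relatively_compact (closure K).
Proof.
move=> pK x; have := pK x; rewrite precompactE => cptKx.
exists (closure [set f x | f in K]); last by split=> //; exact: closed_closure.
move=> _ [f clf <-] B Bfx.
have [g [Kg Bg]] := clf _ (eval_continuous Bfx).
by exists (g x); split=> //; exists g.
Qed.

Lemma equicontinuous_at_closure K x :
  equicontinuous_at K x -> equicontinuous_at (closure K) x.
Proof.
move=> eqK e e0; have e30 : 0 < e / 3 by lra.
apply: filterS (eqK _ e30) => y Ky f clf.
have [g Kg fg] := closure_BC_approx clf e30; have := Ky _ Kg.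
have := metric_triangle (f x) (g x) (f y).
have := metric_triangle (g x) (g y) (f y).
have := le_mdist_BC f g x; have := le_mdist_BC f g y.
rewrite (metric_sym (g y)); lra.
Qed.

Lemma BC_extension_condition_closure K :
  BC_extension_condition K -> BC_extension_condition (closure K).
Proof.
move=> extK e e0; have e30 : 0 < e / 3 by lra.
have [D [d [cptD d0 Dd]]] := extK _ e30.
exists D, (d / 3); split=> // [|f g clf clg fgd]; first by lra.
have r0 : 0 < Num.min (d / 3) (e / 3) by rewrite lt_min; apply/andP; lra.
have [f' Kf' +] := closure_BC_approx clf r0.
have [g' Kg' +] := closure_BC_approx clg r0.
rewrite !lt_min => /andP[gg'd gg'e] /andP[ff'd ff'e].
have : mdist f' g' <= e / 3.
  apply: Dd => //; apply: sup_dist_le => [|x Dx]; first exact: ltW.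
  have := le_sup_dist f g Dx.
  have := metric_triangle (f' x) (f x) (g' x).
  have := metric_triangle (f x) (g x) (g' x).
  have := le_mdist_BC f f' x; have := le_mdist_BC g g' x.
  rewrite (metric_sym (f' x) (f x)); lra.
rewrite -BC_mdistE.
have := metric_triangle f f' g; have := metric_triangle f' g' g.
rewrite (metric_sym g'); lra.
Qed.

(** * Convergence of ultrafilters *)

Section pointwise_limit.
Context {C : set (BC X Y)} {F : set_system (BC X Y)} {l : X -> Y}.
Context {FF : ProperFilter F}.
Hypothesis FC : F C.
Hypothesis eqC : forall x, equicontinuous_at C x.
Hypothesis Fl : forall x, (fun f : BC X Y => f x) @ F --> l x.

Lemma equicontinuous_limit_near x (e : R) : 0 < e ->
  \forall y \near x, mdist (l x) (l y) <= e.
Proof.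
move=> e0; apply: filterS (eqC x e0) => y Cy.
apply: (mdist_lim_le _ (@Fl x) (@Fl y)).
by apply: filterS FC => f /Cy /ltW.
Qed.

Lemma equicontinuous_limit_continuous : continuous l.
Proof. by move=> x; apply/cvgrPdist_le => e; exact: equicontinuous_limit_near. Qed.

(** Equicontinuity turns convergence at [x] into convergence that is uniform on
    a neighbourhood of [x]. *)
Lemma equicontinuous_cvg_on_compact D (e : R) : compact D -> 0 < e ->
  \forall f \near F, forall x, D x -> mdist (BCfun f x) (l x) < e.
Proof.
move=> /compact_near_coveringP covD e0; have e30 : 0 < e / 3 by lra.
apply: (covD _ F (fun (f : BC X Y) x => mdist (f x) (l x) < e)) => x Dx.
have /cvgrPdist_lt Flx := @Fl x.
exists ([set y | mdist (l x) (l y) <= e / 3 /\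
                 forall f, C f -> mdist (f x) (f y) < e / 3],
        C `&` [set f | mdist (l x) (f x) < e / 3]).
  split; apply: filterI => //; last exact: Flx.
  - exact: equicontinuous_limit_near.
  - exact: eqC.
move=> [y f] /= [[lxy Cy] [Cf lfx]]; have := Cy _ Cf.
have := metric_triangle (f y) (f x) (l y).
have := metric_triangle (f x) (l x) (l y).
rewrite (metric_sym (f y) (f x)) (metric_sym (f x) (l x)); lra.
Qed.

(** Two functions that are both close to [l] on the compact set provided by the
    extension condition are close on all of [X]; the limit in one of them then
    compares the other one with [l]. *)
Lemma extension_cvg_uniform (e : R) : BC_extension_condition C -> 0 < e ->
  \forall f \near F, forall x, mdist (BCfun f x) (l x) <= e.
Proof.
move=> extC e0; have [D [d [cptD d0 Dd]]] := extC _ e0.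
have d20 : 0 < d / 2 by lra.
have FD : F (C `&` [set f | forall x, D x -> mdist (f x) (l x) < d / 2]).
  by apply: filterI => //; exact: equicontinuous_cvg_on_compact.
apply: filterS (FD) => f [Cf fl] x.
apply: (mdist_lim_le _ (cvg_cst (f x)) (@Fl x)).
apply: filterS FD => g [Cg gl].
apply: (le_trans (le_BC_dist f g x)); apply: Dd => //.
apply: sup_dist_le => [|y Dy]; first exact: ltW.
have := metric_triangle (f y) (l y) (g y); have := fl _ Dy; have := gl _ Dy.
rewrite (metric_sym (g y)); lra.
Qed.

Lemma extension_cvg : BC_extension_condition C -> exists L : BC X Y, F --> L.
Proof.
move=> extC; have unif := extension_cvg_uniform extC.
have bl : bounded_range l.
  have [f fl] := filter_ex (unif 1 ltr01).
  have [M fM] := BC_bounded f; exists (M + 2) => x y.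
  have := metric_triangle (l x) (f x) (l y).
  have := metric_triangle (f x) (f y) (l y).
  have := fl x; have := fl y; have := fM x y.
  rewrite (metric_sym (l x) (f x)); lra.
exists (MkBC equicontinuous_limit_continuous bl).
apply/fcvgrPdist_lt => e e0; have e20 : 0 < e / 2 by lra.
apply: filterS (unif _ e20) => f fl.
apply: (@le_lt_trans _ _ (e / 2)); last by lra.
apply: BC_dist_le => [|x]; first exact: ltW.
by rewrite metric_sym; exact: fl.
Qed.

End pointwise_limit.

(** Closedness of [C] is what keeps the limit of the ultrafilter in [C]; its
    existence as a function comes from the values, point by point. *)
Lemma closed_extension_compact C :
  closed C -> pointwise_relatively_compact C ->
  (forall x, equicontinuous_at C x) -> BC_extension_condition C -> compact C.
Proof.
move=> clC pC eqC extC; rewrite compact_ultra => F FU FC.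
have /choice[l Fl] (x : X) : exists p : Y, (fun f : BC X Y => f x) @ F --> p.
  have [B CB [cptB _]] := pC x; apply: ultra_cvg_in_compact cptB _.
  by apply: filterS FC => f Cf; apply: CB; exists f.
have [L FL] := extension_cvg FC eqC Fl extC.
exists L; split=> //; apply: clC => B BL.
by apply: (@filter_ex _ F); apply: filterI FC _; exact: FL.
Qed.

End bounded_continuous_functions.

Theorem theorem2 (R : realType) (X : topologicalType) (Y : metricType R)
    (X_sigma_locally_compact : sigma_locally_compact X)
    (X_hausdorff : hausdorff_space X)
    (Y_complete : complete_metric Y)
    (K : set (BC X Y)) :
  precompact K <->
  (pointwise_relatively_compact K /\ (forall x : X, equicontinuous_at K x)) /\
  BC_extension_condition K.
Proof.
split=> [[C KC [cptC _]]|[[pK eqK] extK]].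
  split; first split=> x.
  - apply: precompact_subset (compact_pointwise_relatively_compact cptC x).
    exact: image_subset.
  - move=> e e0; have eqC := @compact_equicontinuous R X Y C x cptC.
    by apply: filterS (eqC _ e0) => y Cy f /KC; exact: Cy.
  move=> e /(compact_extension_condition cptC)[D [d [cptD d0 Dd]]].
  by exists D, d; split=> // f g /KC Cf /KC Cg; exact: Dd.
rewrite precompactE; apply: closed_extension_compact.
- exact: closed_closure.
- exact: pointwise_relatively_compact_closure.
- by move=> x; exact: equicontinuous_at_closure.
- exact: BC_extension_condition_closure.
Qed.
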